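(* Let $G=U(m)$ or $G=SU(m)$ with Lie algebra $\mathfrak g$, and let $p_1\in I^2(\mathfrak g)$ be the first Pontryagin polynomial. For $n\ge 0$ let $\chi_n=\int_{\Delta^n}p_1\circ(\kappa_n\wedge\kappa_n)\in\Omega^{4-n}(EG_n)$ be the forms obtained by applying Shulman's construction to $p_1$. Then $$\chi_1=\frac{1}{24\pi^2}\,\mathrm{Tr}(\bar\omega_1\cdot\bar\omega_1\cdot\bar\omega_1),$$ $$\chi_2=\frac{1}{8\pi^2}\left(\mathrm{Tr}(\bar\omega_1\cdot\bar\omega_2)-\mathrm{Tr}(\bar\omega_1)\cdot\mathrm{Tr}(\bar\omega_2)\right),$$ $$\chi_n=0\quad\text{for all } n\neq 1,2,$$ where $\bar\omega_i=\omega_i-\omega_0$.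
   Context: The Pontryagin polynomials are defined by $\det\left(t\cdot\mathrm{id}-\frac1{2\pi}A\right)=\sum_{k=0}^m p_{k/2}(A,\dots,A)\,t^{m-k}$ for $A\in\mathfrak g$ an $m\times m$ matrix, where $p_{k/2}$ is the symmetric $k$-linear form on $\mathfrak g$ obtained by polarization; $p_1$ is the case $k=2$. $I^k(\mathfrak g)$ denotes the symmetric $k$-linear $\mathrm{Ad}$-invariant forms on $\mathfrak g$. $\Delta^n=\{(t_0,\dots,t_n)\in\mathbb R^{n+1}:\sum t_i=1,\ t_i\ge0\}$, oriented by $(t_1,\dots,t_n)$. $EG_n=G^{n+1}$, and $\omega_j$ is the pullback of the left Maurer-Cartan form $\omega_S(A)=S^{-1}A$ of $G$ along the $j$-th projection $G^{n+1}\to G$, $j=0,\dots,n$ (also pulled back to $\Delta^n\times EG_n$). On $\Delta^n\times EG_n$ let $\hat\omega_n=\sum_{j=0}^n t_j\,\omega_j$ and let $\kappa_n=d\hat\omega_n+\frac12[\hat\omega_n\wedge\hat\omega_n]$ be its curvature. Shulman's construction associates to $f\in I^k(\mathfrak g)$ the forms $\chi_n(f)=\int_{\Delta^n}f\circ\bigwedge^k\kappa_n$ on $EG_n$. Integration along the fiber $\Delta^n$ of a $k$-form $\phi$ on $\Delta^n\times M$: $\left(\int_{\Delta^n}\phi\right)_p(u_1,\dots,u_{k-n})=\int_{\Delta^n\times\{p\}}\phi(\cdot,\dots,\cdot,\tilde u_1,\dots,\tilde u_{k-n})$, with $\tilde u_i$ lifts of $u_i$ in the last slots (and the result is $0$ if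 $n>k$). Wedge conventions: for a $V$-valued $j$-form $\phi$ and a $W$-valued $k$-form $\psi$, $(\phi\wedge\psi)(v_1,\dots,v_{j+k})=\frac{1}{j!k!}\sum_{\sigma\in\mathfrak S_{j+k}}\mathrm{sign}(\sigma)\,\phi(v_{\sigma(1)},\dots)\otimes\psi(v_{\sigma(j+1)},\dots)$; $[\phi\wedge\psi]$ is the same with $\otimes$ replaced by the Lie bracket. For a multilinear map $f$, $f\circ\bigwedge\phi_i=f(\phi_1,\dots,\phi_k)$ means the induced linear map on the tensor product composed with $\phi_1\wedge\dots\wedge\phi_k$. So $\mathrm{Tr}(\phi\cdot\psi\cdot\chi)$, $\mathrm{Tr}(\phi\cdot\psi)$, $\mathrm{Tr}(\phi)\cdot\mathrm{Tr}(\psi)$ come from the multilinear maps $\mathrm{Tr}(ABC)$, $\mathrm{Tr}(AB)$, $\mathrm{Tr}(A)\mathrm{Tr}(B)$. *)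

(* Defs.v *)
(* Complex numbers are R[i] for a realType R. *)
From mathcomp Require Import all_boot all_order all_algebra all_fingroup.
From mathcomp Require Import all_classical all_reals all_analysis.
From mathcomp Require Import complex.

Set Implicit Arguments.
Unset Strict Implicit.
Unset Printing Implicit Defensive.

Import Order.TTheory GRing.Theory Num.Theory.
Import numFieldNormedType.Exports.

Local Open Scope ring_scope.
Local Open Scope complex_scope.
Local Open Scope sesquilinear_scope.
Local Open Scope classical_set_scope.

Variant gauge_group := UnitaryGroup | SpecialUnitaryGroup.

Section MatrixGroups.
Variables (R : realType) (m : nat).
Implicit Types (G : gauge_group) (S A B : 'M[R[i]]_m).

Definition in_group G S : bool :=
  match G with
  | UnitaryGroup => S \is unitarymx
  | SpecialUnitaryGroup => (S \is unitarymx) && (\det S == 1)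
  end.

Definition in_lie G A : bool :=
  match G with
  | UnitaryGroup => A ^t* == - A
  | SpecialUnitaryGroup => (A ^t* == - A) && (\tr A == 0)
  end.

(* T_S G = S g, as a real subspace of M_m(C). *)
Definition in_tangent G S A : bool := in_lie G (invmx S *m A).

Definition lie_bracket A B : 'M[R[i]]_m := A *m B - B *m A.

End MatrixGroups.

Section Pontryagin.
Variables (R : realType) (m : nat).

(* The value on A of the k-th polynomial: the coefficient of t^(m-k) in
   det(t id - A / (2 pi)).  It is 0 for k > m, where there is no such
   coefficient. *)
Definition pontryagin_poly (k : nat) (A : 'M[R[i]]_m) : R[i] :=
  if (k <= m)%N then (char_poly (((2 * pi)^-1)%:C *: A))`_(m - k) else 0.

(* Polarization of a homogeneous polynomial F of degree k: the symmetric
   k-linear form whose value on (A, ..., A) is F A. *)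
Definition polarization (k : nat) (F : 'M[R[i]]_m -> R[i])
    (A : 'I_k -> 'M[R[i]]_m) : R[i] :=
  k`!%:R^-1 *
  \sum_(s : {set 'I_k}) (-1) ^+ (k - #|s|) * F (\sum_(i in s) A i).

Definition pontryagin_form (k : nat) : ('I_k -> 'M[R[i]]_m) -> R[i] :=
  polarization (pontryagin_poly k).

(* p_{k/2} for k = 2 *)
Definition p1 (A B : 'M[R[i]]_m) : R[i] :=
  pontryagin_form (tnth [tuple A; B]).

End Pontryagin.

(* A V-valued k-form: a point and k tangent vectors give an element of V.
   The manifolds below are submanifolds of real vector spaces, so T is the
   type of vectors of the ambient space. *)
Definition form (X T V : Type) (k : nat) := X -> ('I_k -> T) -> V.

(* phi /\ psi composed with the bilinear map f, with the 1/(j! k!)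
   normalization. *)
Definition wedge (R : realType) (X T V W : Type) (Z : lmodType R[i])
    (f : V -> W -> Z) (j k : nat) (phi : form X T V j) (psi : form X T W k) :
    form X T Z (j + k) :=
  fun x v =>
    (j`! * k`!)%:R^-1 *:
    \sum_(s : 'S_(j + k))
      (-1) ^+ s *: f (phi x (fun i => v (s (lshift k i))))
                     (psi x (fun i => v (s (rshift j i)))).

Section SimplexTimesEG.
Variables (R : realType) (m n : nat).
Local Notation C := R[i].
Local Notation M := 'M[C]_m.

(* The real vector space M_m(C)^(n+1), in which EG_n = G^(n+1) lies. *)
Definition EGamb : zmodType := {ffun 'I_n.+1 -> M}.

Definition in_EG (G : gauge_group) (S : EGamb) : Prop :=
  forall j, in_group G (S j).

Definition in_TEG (G : gauge_group) (S u : EGamb) : Prop :=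
  forall j, in_tangent G (S j) (u j).

(* The real vector space R^(n+1) x M_m(C)^(n+1), in which Delta^n x EG_n
   lies; Delta^n has the barycentric coordinates t_0, ..., t_n. *)
Definition DEGamb : zmodType := ('rV[R]_n.+1 * EGamb)%type.

Definition DEGline (x v : DEGamb) (h : R) : DEGamb :=
  (x.1 + h *: v.1, [ffun j => x.2 j + h%:C *: v.2 j]).

(* Derivative at x in the direction v, with respect to the real structure:
   f need not be holomorphic, and Re f and Im f are derived separately. *)
Definition dir_deriv (f : DEGamb -> C) (x v : DEGamb) : C :=
  (fun h : R => complex.Re (f (DEGline x v h)))^`() 0
  +i* (fun h : R => complex.Im (f (DEGline x v h)))^`() 0.

Definition dir_deriv_mx (f : DEGamb -> M) (x v : DEGamb) : M :=
  \matrix_(a, b) dir_deriv (fun y => f y a b) x v.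

(* Exterior derivative in a vector space, i.e. with the v_i extended to
   constant vector fields.  It is applied to forms given by smooth formulas
   near Delta^n x EG_n; since d commutes with restriction, its value on
   vectors tangent to Delta^n x EG_n is that of the intrinsic d there. *)
Definition ext_deriv (k : nat) (phi : form DEGamb DEGamb M k) :
    form DEGamb DEGamb M k.+1 :=
  fun x v =>
    \sum_(i < k.+1)
      (-1) ^+ i *: dir_deriv_mx (phi ^~ (fun l => v (lift i l))) x (v i).

(* omega_j: the form S^-1 A on the j-th factor; the formula makes sense on
   GL_m(C)^(n+1). *)
Definition omega (j : 'I_n.+1) : form EGamb EGamb M 1 :=
  fun S u => invmx (S j) *m u ord0 j.

Definition omega_bar (j : 'I_n.+1) : form EGamb EGamb M 1 :=
  fun S u => omega j S u - omega ord0 S u.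

Definition pullback (V : Type) (k : nat) (phi : form EGamb EGamb V k) :
    form DEGamb DEGamb V k :=
  fun x v => phi x.2 (fun i => (v i).2).

Definition omega_hat : form DEGamb DEGamb M 1 :=
  fun x v => \sum_(j < n.+1) (x.1 0 j)%:C *: pullback (omega j) x v.

Definition kappa : form DEGamb DEGamb M 2 :=
  fun x v =>
    ext_deriv omega_hat x v +
    2%:R^-1 *: wedge (@lie_bracket R m) omega_hat omega_hat x v.

End SimplexTimesEG.

(* The integral of f over s_1, ..., s_n >= 0, s_1 + ... + s_n <= c, as an
   iterated Lebesgue integral. *)
Fixpoint simplex_iint (R : realType) (n : nat) (c : R) (f : seq R -> R) : R :=
  match n with
  | 0 => f [::]
  | n'.+1 => \int[lebesgue_measure]_(s in `[0, c])
               simplex_iint n' (c - s) (fun ss => f (s :: ss))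
  end.

(* The point of Delta^n with (t_1, ..., t_n) = ss. *)
Definition simplex_point (R : realType) (n : nat) (ss : seq R) : 'rV[R]_n.+1 :=
  \row_(j < n.+1) nth 0 (1 - \sum_(s <- ss) s :: ss) j.

Definition simplex_int (R : realType) (n : nat) (f : 'rV[R]_n.+1 -> R[i]) :
    R[i] :=
  simplex_iint n 1 (fun ss => complex.Re (f (simplex_point n ss)))
  +i* simplex_iint n 1 (fun ss => complex.Im (f (simplex_point n ss))).

(* The coordinate vector field of t_i, i = 1, ..., n (here i - 1 : 'I_n), in
   the chart (t_1, ..., t_n) of Delta^n: t_0 = 1 - t_1 - ... - t_n varies. *)
Definition simplex_dt (R : realType) (n : nat) (i : 'I_n) : 'rV[R]_n.+1 :=
  delta_mx 0 (lift ord0 i) - delta_mx 0 ord0.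

(* Integration along the fiber Delta^n of a k-form: the vectors of the
   simplex are in the first n slots, the lifts (0, u_j) in the last k - n. *)
Definition fiber_int (R : realType) (m n k : nat)
    (phi : form (DEGamb R m n) (DEGamb R m n) R[i] k) :
    form (EGamb R m n) (EGamb R m n) R[i] (k - n) :=
  fun S u =>
    if (n <= k)%N then
      simplex_int (fun t : 'rV[R]_n.+1 =>
        phi (t, S)
          (fun i => nth 0 ([seq (simplex_dt R l, 0) | l <- enum 'I_n] ++
                           [seq (0, u l) | l <- enum 'I_(k - n)]) i))
    else 0.

(* chi_n(f) for f of degree k = 2. *)
Definition shulman (R : realType) (m : nat)
    (f : 'M[R[i]]_m -> 'M[R[i]]_m -> R[i]) (n : nat) :
    form (EGamb R m n) (EGamb R m n) R[i] (4 - n) :=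
  fiber_int (wedge (f : _ -> _ -> R[i]^o) (@kappa R m n) (@kappa R m n)).

Definition chi (R : realType) (m n : nat) :
    form (EGamb R m n) (EGamb R m n) R[i] (4 - n) :=
  shulman (@p1 R m) (n := n).

Section TraceForms.
Variables (R : realType) (m : nat) (X T : Type).
Local Notation M := 'M[R[i]]_m.

(* Tr (phi . psi), from the bilinear map Tr (A B). *)
Definition tr_mul2 (j k : nat) (phi : form X T M j) (psi : form X T M k) :
    form X T R[i] (j + k) :=
  wedge (fun A B : M => \tr (A *m B) : R[i]^o) phi psi.

(* Tr (phi . psi . xi), from the trilinear map Tr (A B C). *)
Definition tr_mul3 (j k l : nat) (phi : form X T M j) (psi : form X T M k)
    (xi : form X T M l) : form X T R[i] (j + k + l) :=
  wedge (fun A B : M => \tr (A *m B) : R[i]^o)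
    (wedge (fun A B : M => A *m B) phi psi) xi.

(* Tr (phi) . Tr (psi), from the bilinear map Tr (A) Tr (B). *)
Definition tr_tr (j k : nat) (phi : form X T M j) (psi : form X T M k) :
    form X T R[i] (j + k) :=
  wedge (fun A B : M => \tr A * \tr B : R[i]^o) phi psi.

End TraceForms.

(* Main.v *)
Require Import Defs.
From mathcomp Require Import all_boot all_order all_algebra all_fingroup.
From mathcomp Require Import all_classical all_reals all_analysis.
From mathcomp Require Import complex ring.

Set Implicit Arguments.
Unset Strict Implicit.
Unset Printing Implicit Defensive.

Import Order.TTheory GRing.Theory Num.Theory.
Import numFieldNormedType.Exports.

Local Open Scope ring_scope.
Local Open Scope complex_scope.

(** The reason for the formulas is that the curvature of the interpolated
    connection, the sum of the t_j omega_j, is explicit. The Maurer-Cartan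
    equation gives d(omega_j)(u, w) = - [omega_j u, omega_j w], hence [kappaE]:
    the curvature is the sum of the dt_j /\ omega_j, minus the t-average of the
    brackets [omega_j u, omega_j w], plus the bracket of the t-averages of
    omega_j u and omega_j w. Its values are as follows.

    - Two simplex vectors give 0 ([curvature_vert_vert]).
    - The vector of t_i and a vector u of EG_n give omega_bar_i(u), whatever
      t is ([curvature_simplex_dt]): t_0 decreases as t_i grows.
    - Two vectors of EG_n give minus a covariance, with weights t and the Lie
      bracket as product ([curvature_hor_hor]). A covariance is invariant under
      translation ([lie_cov_shift]), so the omega_j may be replaced by the
      omega_bar_j. For n = 0 nothing remains, and for n = 1 the value is
      (t_1^2 - t_1) [omega_bar_1 u, omega_bar_1 w].

    Since p_1 is symmetric, p_1 of the square of the curvature is twice the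
    alternating sum over the three splittings of four vectors into two pairs
    ([wedge22], [chiE]). The fibre integral puts n simplex vectors among the
    four. If n >= 3 two of them share a pair; if n = 0 the curvature is 0. If
    n = 2 each pair contains one of them, the integrand is constant in t, and
    minus p_1 of omega_bar_1 /\ omega_bar_2 results. If n = 1 one pair consists
    of two vectors of EG_1, and the integral of t^2 - t is -1/6.

    The traces appear because p_1(A, B) = (tr A tr B - tr (A B)) / (8 pi^2)
    ([p1E]): the coefficient defining p_1 is the second elementary symmetric
    function of the eigenvalues. The Maurer-Cartan equation, with derivatives of
    real and imaginary parts, comes from the derivative of the matrix inverse
    along a line ([has_deriv0_invmx_mul]). *)

(** * The first Pontryagin form *)

Section Pontryagin.

Lemma char_poly_conj (F : fieldType) n (P A B : 'M[F]_n) :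
  P \in unitmx -> P *m A = B *m P -> char_poly A = char_poly B.
Proof.
move=> Pu PAB; rewrite /char_poly /char_poly_mx.
have detP : \det (map_mx polyC P) != 0.
  by rewrite det_map_mx polyC_eq0 -unitfE.
apply: (mulfI detP); rewrite -det_mulmx [RHS]mulrC -det_mulmx.
congr (\det _); rewrite mulmxBr mulmxBl -!map_mxM PAB.
by rewrite mul_mx_scalar mul_scalar_mx.
Qed.

(** Twice the second elementary symmetric function is the square of the sum
    minus the sum of squares; adding a root [a] adds to it [2 a] times the sum
    of the previous roots, which up to sign is the next coefficient. *)
Lemma coefPnn_prod_XsubC (R : comNzRingType) (ps : seq R) n :
  size ps = n.+2 ->
  (\prod_(p <- ps) ('X - p%:P))`_n *+ 2 =
  (\sum_(p <- ps) p) ^+ 2 - \sum_(p <- ps) p ^+ 2.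
Proof.
elim: ps n => [//|a ps IH] n /= [szps].
rewrite !big_cons mulrBl coefB coefXM coefCM.
have -> : (\prod_(p <- ps) ('X - p%:P))`_n = - \sum_(p <- ps) p.
  by rewrite -coefPn_prod_XsubC szps.
case: n szps => [|n] szps; last first.
  rewrite /= mulrnBl IH //; ring.
case: ps szps {IH} => [//|b [|//]] _.
by rewrite /= !big_cons !big_nil; ring.
Qed.

Lemma trig_mulmx_diag (R : pzRingType) n (A : 'M[R]_n) i :
  is_trig_mx A -> (A *m A) i i = A i i * A i i.
Proof.
move=> /is_trig_mxP A0; rewrite mxE (bigD1 i) //= big1 ?addr0 // => j jNi.
case: (ltngtP i j) => [ij|ji|/val_inj ij].
- by rewrite A0 ?mul0r.
- by rewrite [A j i]A0 ?mulr0.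
- by rewrite ij eqxx in jNi.
Qed.

(** Both sides are invariant under conjugation, and for a triangular matrix
    they are symmetric functions of the diagonal entries. *)
Lemma char_poly_coef2 (C : numClosedFieldType) n (A : 'M[C]_n.+2) :
  (char_poly A)`_n *+ 2 = (\tr A) ^+ 2 - \tr (A *m A).
Proof.
have [P Punitary trigB] := Schur A (ltn0Sn _).
have Pu := unitarymx_unit Punitary.
move: trigB; rewrite /similar_to conjumx //; set B := P *m A *m _ => trigB.
have PAB : P *m A = B *m P by rewrite /B mulmxKV.
have ->: A = invmx P *m B *m P by rewrite -mulmxA -PAB mulKmx.
have ->: char_poly (invmx P *m B *m P) = char_poly B.
  by apply: (char_poly_conj Pu); rewrite !mulmxA mulmxV ?mul1mx.
have ->: \tr (invmx P *m B *m P) = \tr B.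
  by rewrite mxtrace_mulC mulmxA mulmxV // mul1mx.
have ->: \tr (invmx P *m B *m P *m (invmx P *m B *m P)) = \tr (B *m B).
  by rewrite !mulmxA mulmxK // mxtrace_mulC !mulmxA mulmxV ?mul1mx.
rewrite char_poly_trig //.
rewrite -(big_map (fun i => B i i) xpredT (fun b => 'X - b%:P)).
rewrite coefPnn_prod_XsubC; last first.
  by rewrite size_map -[index_enum _]enumT size_enum_ord.
rewrite !big_map; congr (_ - _).
by apply: eq_bigr => i _; rewrite trig_mulmx_diag // expr2.
Qed.

(** The sizes 0 and 1 are separate: there the polynomial is 0 by convention,
    and so is the right-hand side. *)
Lemma pontryagin_poly2 (R : realType) m (A : 'M[R[i]]_m) :
  pontryagin_poly 2 A =
  ((8 * pi ^+ 2)^-1)%:C * ((\tr A) ^+ 2 - \tr (A *m A)).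
Proof.
rewrite /pontryagin_poly; case: m A => [|[|m]] A /=.
- by rewrite /mxtrace !big_ord0 expr0n subrr mulr0.
- by rewrite /mxtrace !big_ord1 mxE big_ord1 -[A _ _ * _]expr2 subrr mulr0.
apply: (@mulIf _ 2%:R); first by rewrite pnatr_eq0.
rewrite mulr_natr [(m.+2 - 2)%N]subn2 /= char_poly_coef2.
rewrite -scalemxAl -scalemxAr !mxtraceZ.
have ->: ((8 * pi ^+ 2)^-1)%:C = ((2 * pi)^-1)%:C ^+ 2 / 2%:R :> R[i].
  have -> : 2%:R = (2%:R)%:C :> R[i] by rewrite rmorph_nat.
  rewrite -rmorphXn /= -fmorphV.
  rewrite -rmorphM /=; congr (_ %:C).
  have := pi_gt0 R; move: pi => p p0; field; rewrite ?gt_eqF //.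
move: (_%:C) (\tr A) (\tr _) => c x y.
by field.
Qed.

Lemma sum_set_ord2 (V : nmodType) (F : {set 'I_2} -> V) :
  \sum_s F s = F finset.set0 + F [set ord0]%SET + F [set ord_max]%SET +
               F [set: 'I_2]%SET.
Proof.
have ord2 (i : 'I_2) : i = ord0 \/ i = ord_max.
  by case: i => -[|[|//]] i2; [left|right]; apply: val_inj.
have neq_set (a b : {set 'I_2}) i : (i \in a) != (i \in b) -> a != b.
  by apply: contra_neq => ->.
rewrite (bigD1 finset.set0) //= (bigD1 [set ord0]%SET) /=; last first.
  by apply: (neq_set _ _ ord0); rewrite !inE.
rewrite (bigD1 [set ord_max]%SET) /=; last first.
  by apply/andP; split; apply: (neq_set _ _ ord_max); rewrite !inE.
rewrite (bigD1 [set: 'I_2]%SET) /=; last first.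
  by rewrite -!andbA; apply/and3P; split;
     [apply: (neq_set _ _ ord0)|apply: (neq_set _ _ ord_max)
     |apply: (neq_set _ _ ord0)]; rewrite !inE.
rewrite big1 ?addr0 ?addrA // => s /andP[/andP[/andP[s0 s1] s2] sT]; exfalso.
case s0E: (ord0 \in s); case s1E: (ord_max \in s).
- by case/eqP: sT; apply/setP => i; case: (ord2 i) => ->;
  rewrite ?s0E ?s1E !inE.
- by case/eqP: s1; apply/setP => i; case: (ord2 i) => ->;
  rewrite ?s0E ?s1E !inE.
- by case/eqP: s2; apply/setP => i; case: (ord2 i) => ->;
  rewrite ?s0E ?s1E !inE.
- by case/eqP: s0; apply/setP => i; case: (ord2 i) => ->;
  rewrite ?s0E ?s1E !inE.
Qed.

Lemma p1E (R : realType) m (A B : 'M[R[i]]_m) :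
  p1 A B = ((8 * pi ^+ 2)^-1)%:C * (\tr A * \tr B - \tr (A *m B)).
Proof.
rewrite /p1 /pontryagin_form /polarization sum_set_ord2.
rewrite finset.big_set0 !finset.big_set1 (eq_bigl xpredT) => [|i]; last first.
  by rewrite finset.in_setT.
rewrite big_ord_recl big_ord1.
have -> : lift ord0 ord0 = ord_max :> 'I_2 by apply: val_inj.
rewrite finset.cards0 !finset.cards1 cardsT card_ord /= !(tnth_nth 0) /=.
rewrite !pontryagin_poly2 !mulmxDl !mulmxDr !mxtraceD mul0mx !mxtrace0.
rewrite (mxtrace_mulC B A) expr0 expr1 expr2.
have -> : 2`!%:R = 2%:R :> R[i] by [].
move: (_%:C) => c.
by field.
Qed.

End Pontryagin.

(** * Alternating sums and wedge products *)

Section AlternatingSums.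

(** The arguments of [F] form a sequence and those of [v] are numbers, so that
    the expansion along the first argument stays within one definition and
    computes on numerals. *)
Definition alt_sum (Z : zmodType) (T : Type) n (F : seq T -> Z)
    (v : nat -> T) : Z :=
  \sum_(s : 'S_n)
    (if odd_perm s then - F [seq v (s i) | i <- enum 'I_n]
     else F [seq v (s i) | i <- enum 'I_n]).

Lemma alt_sum0 (Z : zmodType) (T : Type) (F : seq T -> Z) v :
  alt_sum 0 F v = F [::].
Proof.
rewrite /alt_sum (big_pred1 1%g) => [|s]; last first.
  by apply/esym/eqP/permP => -[].
by rewrite odd_perm1; congr F; apply: size0nil; rewrite size_map size_enum_ord.
Qed.

(** A permutation of n+1 points is the image [i] of the first point together
    with a permutation of the n others, and moving [i] to the front contributes
    the sign (-1)^i; this is the expansion of a determinant along a row. *)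
Lemma alt_sumS (Z : zmodType) (T : Type) n (F : seq T -> Z) v :
  alt_sum n.+1 F v =
  \sum_(i < n.+1)
    (if odd i then - alt_sum n (fun w => F (v i :: w)) (v \o bump i)
     else alt_sum n (fun w => F (v i :: w)) (v \o bump i)).
Proof.
rewrite /alt_sum (partition_big (fun s : 'S_n.+1 => s ord0) xpredT) //=.
apply: eq_bigr => i _.
rewrite (reindex (fun s : 'S_n => lift_perm ord0 i s)) /=; last first.
  (* The permutation of the other points: delete 0 from the source of s and
     s 0 from its target, and renumber. *)
  pose lower (s : 'S_n.+1) k := odflt k (unlift (s ord0) (s (lift ord0 k))).
  have lowerK (s : 'S_n.+1) k : lift (s ord0) (lower s k) = s (lift ord0 k).
    rewrite /lower; case: unliftP => //= /perm_inj /eqP.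
    by rewrite eq_sym (negbTE (neq_lift _ _)).
  have lower_inj s : injective (lower s).
    move=> k l /(congr1 (lift (s ord0))); rewrite !lowerK.
    by move/perm_inj/lift_inj.
  exists (fun s => perm (@lower_inj s)) => s; rewrite !inE => /eqP s0i.
    apply/permP => k; rewrite permE; apply: (@lift_inj _ i).
    by rewrite -{1}s0i lowerK lift_perm_lift.
  apply/permP => k; case: (unliftP ord0 k) => [l|] ->; last first.
    by rewrite lift_perm_id.
  by rewrite lift_perm_lift permE -s0i lowerK.
rewrite (eq_bigl xpredT) => [|s]; last by rewrite lift_perm_id eqxx.
have map_lift (s : 'S_n) : [seq v (lift_perm ord0 i s k) | k <- enum 'I_n.+1] =
    v i :: [seq v (bump i (s k)) | k <- enum 'I_n].
  rewrite enum_ordSl /= lift_perm_id -map_comp; congr cons.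
  by apply: eq_map => k /=; rewrite lift_perm_lift.
case: ifP => oddi; rewrite -?sumrN; apply: eq_bigr => s _;
  rewrite map_lift odd_lift_perm /= oddi /=;
  by case: (odd_perm s); rewrite ?opprK.
Qed.

Lemma alt_sum2 (Z : zmodType) (T : Type) (F : seq T -> Z) v :
  alt_sum 2 F v = F [:: v 0%N; v 1%N] - F [:: v 1%N; v 0%N].
Proof.
by rewrite !(alt_sumS, alt_sum0, big_ord_recl, big_ord0) /= !addr0.
Qed.

Lemma alt_sum3 (Z : zmodType) (T : Type) (F : seq T -> Z) v :
  alt_sum 3 F v =
  (F [:: v 0%N; v 1%N; v 2%N] - F [:: v 0%N; v 2%N; v 1%N]) -
  (F [:: v 1%N; v 0%N; v 2%N] - F [:: v 1%N; v 2%N; v 0%N]) +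
  (F [:: v 2%N; v 0%N; v 1%N] - F [:: v 2%N; v 1%N; v 0%N]).
Proof.
by rewrite alt_sumS !big_ord_recl big_ord0 !alt_sum2 /= addr0 addrA.
Qed.

Lemma alt_sum4 (Z : zmodType) (T : Type) (F : seq T -> Z) v :
  alt_sum 4 F v =
  ((F [:: v 0%N; v 1%N; v 2%N; v 3%N] - F [:: v 0%N; v 1%N; v 3%N; v 2%N]) -
   (F [:: v 0%N; v 2%N; v 1%N; v 3%N] - F [:: v 0%N; v 2%N; v 3%N; v 1%N]) +
   (F [:: v 0%N; v 3%N; v 1%N; v 2%N] - F [:: v 0%N; v 3%N; v 2%N; v 1%N])) -
  ((F [:: v 1%N; v 0%N; v 2%N; v 3%N] - F [:: v 1%N; v 0%N; v 3%N; v 2%N]) -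
   (F [:: v 1%N; v 2%N; v 0%N; v 3%N] - F [:: v 1%N; v 2%N; v 3%N; v 0%N]) +
   (F [:: v 1%N; v 3%N; v 0%N; v 2%N] - F [:: v 1%N; v 3%N; v 2%N; v 0%N])) +
  ((F [:: v 2%N; v 0%N; v 1%N; v 3%N] - F [:: v 2%N; v 0%N; v 3%N; v 1%N]) -
   (F [:: v 2%N; v 1%N; v 0%N; v 3%N] - F [:: v 2%N; v 1%N; v 3%N; v 0%N]) +
   (F [:: v 2%N; v 3%N; v 0%N; v 1%N] - F [:: v 2%N; v 3%N; v 1%N; v 0%N])) -
  ((F [:: v 3%N; v 0%N; v 1%N; v 2%N] - F [:: v 3%N; v 0%N; v 2%N; v 1%N]) -
   (F [:: v 3%N; v 1%N; v 0%N; v 2%N] - F [:: v 3%N; v 1%N; v 2%N; v 0%N]) +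
   (F [:: v 3%N; v 2%N; v 0%N; v 1%N] - F [:: v 3%N; v 2%N; v 1%N; v 0%N])).
Proof.
by rewrite alt_sumS !big_ord_recl big_ord0 !alt_sum3 /= addr0 !addrA.
Qed.

End AlternatingSums.

Section Wedge.
Variables (R : realType) (X T V W : Type).
Local Notation C := R[i].

Lemma sum_sign_alt (Z : lmodType C) n (G : ('I_n.+1 -> T) -> Z)
    (v : 'I_n.+1 -> T) :
  \sum_(s : 'S_n.+1) (-1) ^+ s *: G (fun i => v (s i)) =
  alt_sum n.+1 (fun w => G (fun i => nth (v ord0) w i)) (fun k => v (inord k)).
Proof.
apply: eq_bigr => s _; rewrite scaler_sign.
have -> // : (fun i : 'I_n.+1 =>
      nth (v ord0) [seq v (inord (s k)) | k <- enum 'I_n.+1] i) =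
    (fun i => v (s i)).
apply/funext => i; rewrite (nth_map ord0) ?size_enum_ord //.
by rewrite nth_ord_enum inord_val.
Qed.

Lemma wedge11 (Z : lmodType C) (f : V -> W -> Z) (phi : Defs.form X T V 1)
    (psi : Defs.form X T W 1) x v :
  wedge f phi psi x v =
  f (phi x (fun=> v (inord 0))) (psi x (fun=> v (inord 1))) -
  f (phi x (fun=> v (inord 1))) (psi x (fun=> v (inord 0))).
Proof.
rewrite /wedge (sum_sign_alt (n := 1) (fun w =>
  f (phi x (fun i => w (lshift 1 i))) (psi x (fun i => w (rshift 1 i))))).
rewrite alt_sum2 /= invr1 scale1r.
have cst (g : 'I_1 -> T) : g = (fun=> g ord0).
  by apply/funext => i; rewrite ord1.
by congr (f (phi x _) (psi x _) - f (phi x _) (psi x _)); rewrite [LHS]cst.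
Qed.

(** Of the six terms, those that differ by the exchange of the two arguments
    of the 2-form agree, which cancels the factor 1/2!. *)
Lemma wedge21 (f : V -> W -> C) (phi : Defs.form X T V 2)
    (psi : Defs.form X T W 1) x v (Phi : T -> T -> V) :
  (forall w, phi x w = Phi (w (inord 0)) (w (inord 1))) ->
  (forall a b c, f (Phi a b) c = - f (Phi b a) c) ->
  wedge (f : V -> W -> C^o) phi psi x v =
  f (Phi (v (inord 0)) (v (inord 1))) (psi x (fun=> v (inord 2))) -
  f (Phi (v (inord 0)) (v (inord 2))) (psi x (fun=> v (inord 1))) +
  f (Phi (v (inord 1)) (v (inord 2))) (psi x (fun=> v (inord 0))).
Proof.
move=> phiE fN.
rewrite /wedge (sum_sign_alt (Z := C^o) (n := 2) (fun w =>
  f (phi x (fun i => w (lshift 1 i))) (psi x (fun i => w (rshift 2 i))))).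
have psiE d a b c : psi x (fun i : 'I_1 => nth d [:: a; b; c] (rshift 2 i)) =
    psi x (fun=> c).
  by congr (psi x _); apply/funext => i; rewrite ord1.
have -> : (2`! * 1`!)%:R = 2%:R :> C by [].
rewrite alt_sum3; cbv beta; rewrite !psiE !phiE /= !inordK //=.
rewrite (fN (v (inord 2)) (v (inord 0))) (fN (v (inord 2)) (v (inord 1))).
rewrite (fN (v (inord 1)) (v (inord 0))) /GRing.scale /=.
by field.
Qed.

(** The 24 terms come in three families of 8, one for each way of splitting
    the four vectors into two pairs: orienting a pair or exchanging the pairs
    does not change a term, so that 8 / (2! 2!) = 2 remains. *)
Lemma wedge22 (f : V -> V -> C) (phi : Defs.form X T V 2) x v
    (Phi : T -> T -> V) :
  (forall w, phi x w = Phi (w (inord 0)) (w (inord 1))) ->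
  (forall a b c, f (Phi a b) c = - f (Phi b a) c) ->
  (forall a b, f a b = f b a) ->
  wedge (f : V -> V -> C^o) phi phi x v =
  (f (Phi (v (inord 0)) (v (inord 1))) (Phi (v (inord 2)) (v (inord 3))) -
   f (Phi (v (inord 0)) (v (inord 2))) (Phi (v (inord 1)) (v (inord 3))) +
   f (Phi (v (inord 0)) (v (inord 3))) (Phi (v (inord 1)) (v (inord 2)))) *+ 2.
Proof.
move=> phiE fN fC.
rewrite /wedge (sum_sign_alt (Z := C^o) (n := 3) (fun w =>
  f (phi x (fun i => w (lshift 2 i))) (phi x (fun i => w (rshift 2 i))))).
have -> : (2`! * 2`!)%:R = 4%:R :> C by [].
rewrite alt_sum4; cbv beta; rewrite !phiE /= !inordK //=.
set v0 := v _; set v1 := v _; set v2 := v _; set v3 := v _.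
have fN' a b c : f c (Phi a b) = - f c (Phi b a).
  by rewrite fC fN fC.
rewrite !(fN v1 v0) !(fN v2 v0) !(fN v3 v0) !(fN v2 v1) !(fN v3 v1) !(fN v3 v2).
rewrite !(fN' v1 v0) !(fN' v2 v0) !(fN' v3 v0).
rewrite !(fN' v2 v1) !(fN' v3 v1) !(fN' v3 v2).
rewrite (fC (Phi v2 v3)) (fC (Phi v1 v3)) (fC (Phi v1 v2)) /GRing.scale /=.
by field.
Qed.

End Wedge.

(** * Derivatives of complex-valued functions of a real variable *)

Lemma ReM (R : realType) (x y : R[i]) : complex.Re (x * y) =
  complex.Re x * complex.Re y - complex.Im x * complex.Im y.
Proof. by case: x y => [a b] [c d]. Qed.

Lemma ImM (R : realType) (x y : R[i]) : complex.Im (x * y) =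
  complex.Re x * complex.Im y + complex.Im x * complex.Re y.
Proof. by case: x y => [a b] [c d]. Qed.

Section Derivatives.
Variable R : realType.
Local Notation C := R[i].
Implicit Types f g k : R -> C.

(** Continuity at 0 is asked of the real and imaginary parts because
    directional derivatives are taken part by part. *)
Definition ccontinuous0 f :=
  (complex.Re (f h) @[h --> (0 : R)] --> complex.Re (f 0))%classic /\
  (complex.Im (f h) @[h --> (0 : R)] --> complex.Im (f 0))%classic.

Lemma eq_ccontinuous0 f g : f =1 g -> ccontinuous0 f -> ccontinuous0 g.
Proof. by move/funext->. Qed.

Lemma ccontinuous0_cst c : ccontinuous0 (fun=> c).
Proof. by split; apply: cvg_cst. Qed.

Lemma ccontinuous0_id : ccontinuous0 (fun h => h%:C).
Proof. by split => /=; [apply: cvg_id | apply: cvg_cst]. Qed.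

Lemma ccontinuous0D f g :
  ccontinuous0 f -> ccontinuous0 g -> ccontinuous0 (fun h => f h + g h).
Proof.
by move=> [rf jf] [rg jg]; split; rewrite raddfD;
  under eq_cvg do rewrite raddfD; apply: cvgD.
Qed.

Lemma ccontinuous0M f g :
  ccontinuous0 f -> ccontinuous0 g -> ccontinuous0 (fun h => f h * g h).
Proof.
move=> [rf jf] [rg jg]; split.
  rewrite ReM; under eq_cvg do rewrite ReM.
  by apply: cvgB; apply: cvgM.
rewrite ImM; under eq_cvg do rewrite ImM.
by apply: cvgD; apply: cvgM.
Qed.

Lemma ccontinuous0V f :
  f 0 != 0 -> ccontinuous0 f -> ccontinuous0 (fun h => (f h)^-1).
Proof.
move=> f0 [rf jf].
have n0 : complex.Re (f 0) ^+ 2 + complex.Im (f 0) ^+ 2 != 0.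
  apply: contra f0; rewrite paddr_eq0 ?sqr_ge0 // !sqrf_eq0.
  by rewrite eq_complex.
have cn : ((complex.Re (f h) ^+ 2 + complex.Im (f h) ^+ 2)^-1 @[h --> (0:R)]
    --> (complex.Re (f 0) ^+ 2 + complex.Im (f 0) ^+ 2)^-1)%classic.
  by apply: cvgV => //; apply: cvgD; apply: cvgM.
have ReV (z : C) : complex.Re z^-1 =
    complex.Re z * (complex.Re z ^+ 2 + complex.Im z ^+ 2)^-1.
  by case: z.
have ImV (z : C) : complex.Im z^-1 =
    - (complex.Im z * (complex.Re z ^+ 2 + complex.Im z ^+ 2)^-1).
  by case: z => a b; rewrite /= ?mulNr.
split.
  by rewrite ReV; under eq_cvg do rewrite ReV; apply: cvgM.
by rewrite ImV; under eq_cvg do rewrite ImV; apply: cvgN; apply: cvgM.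
Qed.

Lemma ccontinuous0_sum I (r : seq I) (P : pred I) (F : I -> R -> C) :
  (forall i, P i -> ccontinuous0 (F i)) ->
  ccontinuous0 (fun h => \sum_(i <- r | P i) F i h).
Proof.
move=> cF; elim: r => [|a r IH].
  by apply: eq_ccontinuous0 (ccontinuous0_cst 0) => h; rewrite big_nil.
have [Pa|nPa] := boolP (P a); last first.
  by apply: eq_ccontinuous0 IH => h; rewrite big_cons (negbTE nPa).
apply: eq_ccontinuous0 (ccontinuous0D (cF a Pa) IH) => h.
by rewrite big_cons Pa.
Qed.

Lemma ccontinuous0_prod I (r : seq I) (P : pred I) (F : I -> R -> C) :
  (forall i, P i -> ccontinuous0 (F i)) ->
  ccontinuous0 (fun h => \prod_(i <- r | P i) F i h).
Proof.
move=> cF; elim: r => [|a r IH].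
  by apply: eq_ccontinuous0 (ccontinuous0_cst 1) => h; rewrite big_nil.
have [Pa|nPa] := boolP (P a); last first.
  by apply: eq_ccontinuous0 IH => h; rewrite big_cons (negbTE nPa).
apply: eq_ccontinuous0 (ccontinuous0M (cF a Pa) IH) => h.
by rewrite big_cons Pa.
Qed.

Lemma ccontinuous0_neq0 f :
  f 0 != 0 -> ccontinuous0 f -> \forall h \near (0 : R), f h != 0.
Proof.
rewrite eq_complex negb_and => /orP[] f0 [rf jf].
  near=> h; have : complex.Re (f h) != 0 by near: h; apply: cvgr_neq0 rf f0.
  by apply: contra_neq => ->.
near=> h; have : complex.Im (f h) != 0 by near: h; apply: cvgr_neq0 jf f0.
by apply: contra_neq => ->.
Unshelve. all: end_near. Qed.

Definition ccontinuous0_mx m n (A : R -> 'M[C]_(m, n)) :=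
  forall i j, ccontinuous0 (fun h => A h i j).

Lemma ccontinuous0_mx_cst m n (A : 'M[C]_(m, n)) : ccontinuous0_mx (fun=> A).
Proof. by move=> i j; apply: ccontinuous0_cst. Qed.

Lemma ccontinuous0_mulmx m n p (A : R -> 'M[C]_(m, n)) (B : R -> 'M[C]_(n, p)) :
  ccontinuous0_mx A -> ccontinuous0_mx B ->
  ccontinuous0_mx (fun h => A h *m B h).
Proof.
move=> cA cB i j.
apply: (@eq_ccontinuous0 (fun h => \sum_l A h i l * B h l j)).
  by move=> h; rewrite mxE.
by apply: ccontinuous0_sum => l _; apply: ccontinuous0M.
Qed.

Lemma ccontinuous0_det n (A : R -> 'M[C]_n) :
  ccontinuous0_mx A -> ccontinuous0 (fun h => \det (A h)).
Proof.
move=> cA; apply: ccontinuous0_sum => s _; apply: ccontinuous0M.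
  exact: ccontinuous0_cst.
by apply: ccontinuous0_prod.
Qed.

Lemma ccontinuous0_adj n (A : R -> 'M[C]_n) :
  ccontinuous0_mx A -> ccontinuous0_mx (fun h => \adj (A h)).
Proof.
move=> cA i j.
apply: (@eq_ccontinuous0 (fun h => cofactor (A h) j i)).
  by move=> h; rewrite mxE.
apply: ccontinuous0M; first exact: ccontinuous0_cst.
apply: ccontinuous0_det => k l.
apply: (@eq_ccontinuous0 (fun h => A h (lift j k) (lift i l))) => // h.
by rewrite !mxE.
Qed.

(** Caratheodory's form of differentiability at 0: the difference quotient is
    near 0 a function that is continuous at 0, and its value there is the
    derivative. Products then need no limit computation. *)
Definition has_deriv0 f d := exists2 k : R -> C,
  ccontinuous0 k /\ k 0 = d &
  \forall h \near (0 : R), f h = f 0 + h%:C * k h.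

Lemma has_deriv0_affine (c d : R) :
  has_deriv0 (fun h => (c + h * d)%:C) d%:C.
Proof.
exists (fun=> d%:C); first by split=> //; apply: ccontinuous0_cst.
by near=> h; rewrite mul0r addr0 rmorphD rmorphM.
Unshelve. all: end_near. Qed.

Lemma has_deriv0M f g df dg : has_deriv0 f df -> has_deriv0 g dg ->
  has_deriv0 (fun h => f h * g h) (df * g 0 + f 0 * dg).
Proof.
move=> [k [ck <-] fE] [l [cl <-] gE].
exists (fun h => k h * (g 0 + h%:C * l h) + f 0 * l h).
  split; last by rewrite mul0r addr0.
  apply: ccontinuous0D; apply: ccontinuous0M => //;
    last exact: ccontinuous0_cst.
  apply: ccontinuous0D; first exact: ccontinuous0_cst.
  by apply: ccontinuous0M => //; apply: ccontinuous0_id.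
near=> h.
have -> : f h = f 0 + h%:C * k h by near: h; exact: fE.
have -> : g h = g 0 + h%:C * l h by near: h; exact: gE.
ring.
Unshelve. all: end_near. Qed.

Lemma has_deriv0D f g df dg : has_deriv0 f df -> has_deriv0 g dg ->
  has_deriv0 (fun h => f h + g h) (df + dg).
Proof.
move=> [k [ck <-] fE] [l [cl <-] gE].
exists (fun h => k h + l h); first by split=> //; apply: ccontinuous0D.
near=> h.
have -> : f h = f 0 + h%:C * k h by near: h; exact: fE.
have -> : g h = g 0 + h%:C * l h by near: h; exact: gE.
ring.
Unshelve. all: end_near. Qed.

Lemma has_deriv0_cst c : has_deriv0 (fun=> c) 0.
Proof.
exists (fun=> 0); first by split=> //; apply: ccontinuous0_cst.
by near=> h; rewrite mulr0 addr0.
Unshelve. all: end_near. Qed.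

Lemma has_deriv0_sum I (r : seq I) (F : I -> R -> C) (d : I -> C) :
  (forall i, has_deriv0 (F i) (d i)) ->
  has_deriv0 (fun h => \sum_(i <- r) F i h) (\sum_(i <- r) d i).
Proof.
move=> cF; elim: r => [|a r IH].
  rewrite big_nil (_ : (fun h => _) = fun=> 0); last first.
    by apply/funext => h; rewrite big_nil.
  exact: has_deriv0_cst.
rewrite big_cons (_ : (fun h => _) = fun h => F a h + \sum_(i <- r) F i h).
  exact: has_deriv0D.
by apply/funext => h; rewrite big_cons.
Qed.

Lemma has_deriv0_Re_Im f d : has_deriv0 f d ->
  (fun h => complex.Re (f h))^`()%classic 0 +i*
  (fun h => complex.Im (f h))^`()%classic 0 = d.
Proof.
move=> [k [[rk ik] <-] fE].
have quot (u w : R -> R) : (w h @[h --> (0:R)] --> w 0)%classic ->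
    (\forall h \near (0:R), u h = u 0 + h * w h) -> u^`()%classic 0 = w 0.
  move=> cw uE; rewrite /derive1; apply/cvg_lim => //.
  have cw' : (w h @[h --> (0:R)^'] --> w 0)%classic by apply: cvg_within_filter.
  apply: (cvg_trans _ cw'); apply: near_eq_cvg.
  near=> h.
  have uhE : u h = u 0 + h * w h by near: h; apply: cvg_within uE.
  rewrite addr0 uhE addrAC subrr add0r /GRing.scale /= mulrA mulVf ?mul1r //.
  by near: h; apply: nbhs_dnbhs_neq.
rewrite [RHS](_ : _ = complex.Re (k 0) +i* complex.Im (k 0)); last first.
  by case: (k 0).
congr (_ +i* _).
  apply (quot (fun h => complex.Re (f h)) (fun h => complex.Re (k h)) rk).
  near=> h => /=.
  have -> : f h = f 0 + h%:C * k h by near: h; exact: fE.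
  by rewrite raddfD /= ReM /= mul0r subr0.
apply (quot (fun h => complex.Im (f h)) (fun h => complex.Im (k h)) ik).
near=> h => /=.
have -> : f h = f 0 + h%:C * k h by near: h; exact: fE.
by rewrite raddfD /= ImM /= mul0r addr0.
Unshelve. all: end_near. Qed.

Lemma invmx_resolvent n (A B : 'M[C]_n) : A \in unitmx -> B \in unitmx ->
  invmx B = invmx A - invmx B *m (B - A) *m invmx A.
Proof.
move=> Au Bu; rewrite mulmxBr mulVmx // mulmxBl mul1mx mulmxK //.
by rewrite opprB addrC subrK.
Qed.

(** The resolvent identity exhibits the difference quotient of the inverse along
    A + hB as -(A + hB)^-1 B A^-1, so that continuity of the inverse, which
    Cramer's rule gives, already yields its derivative. *)
Lemma has_deriv0_invmx_mul n p (A B : 'M[C]_n) (W : 'M[C]_(n, p)) a b :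
  A \in unitmx ->
  has_deriv0 (fun h => (invmx (A + h%:C *: B) *m W) a b)
             (- (invmx A *m B *m (invmx A *m W)) a b).
Proof.
move=> Au; pose L h := A + h%:C *: B.
have L0 : L 0 = A by rewrite /L scale0r addr0.
have cL : ccontinuous0_mx L.
  move=> i j.
  apply: (@eq_ccontinuous0 (fun h => A i j + h%:C * B i j)).
    by move=> h; rewrite /L !mxE.
  apply: ccontinuous0D; first exact: ccontinuous0_cst.
  by apply: ccontinuous0M; [apply: ccontinuous0_id | apply: ccontinuous0_cst].
have detL0 : \det (L 0) != 0 by rewrite L0 -unitfE.
pose inv h := (\det (L h))^-1 *: \adj (L h).
have cinv : ccontinuous0_mx inv.
  move=> i j.
  apply: (@eq_ccontinuous0 (fun h => (\det (L h))^-1 * \adj (L h) i j)).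
    by move=> h; rewrite [RHS]mxE.
  apply: ccontinuous0M; last exact: ccontinuous0_adj.
  by apply: ccontinuous0V => //; apply: ccontinuous0_det.
have invE h : \det (L h) != 0 -> inv h = invmx (L h).
  by rewrite -unitfE => Lu; rewrite /invmx unitmxE Lu.
exists (fun h => (-1) * (inv h *m (B *m (invmx A *m W))) a b).
  split; last by rewrite invE // L0 mulN1r !mulmxA.
  apply: ccontinuous0M; first exact: ccontinuous0_cst.
  by apply: ccontinuous0_mulmx => //; apply: ccontinuous0_mx_cst.
near=> h.
have Lh : \det (L h) != 0.
  by near: h; apply: ccontinuous0_neq0 detL0 (ccontinuous0_det cL).
rewrite -/(L h) -/(L 0) L0 invE //.
rewrite {1}(invmx_resolvent Au (B := L h)) ?unitmxE ?unitfE //.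
rewrite [L h - A]addrAC subrr add0r mulmxBl mxE; congr (_ + _).
by rewrite mxE -scalemxAr -!scalemxAl mxE mulrA mulrN1 mulNr !mulmxA.
Unshelve. all: end_near. Qed.

End Derivatives.

(** * The curvature of the interpolated connection *)

Section Curvature.
Variables (R : realType) (m n : nat).
Local Notation C := R[i].
Local Notation M := 'M[C]_m.
Implicit Types (S u : EGamb R m n) (x v w : DEGamb R m n).

(** The Maurer-Cartan form of the j-th factor. *)
Definition mc S (j : 'I_n.+1) u : M := invmx (S j) *m u j.

(** For a point t of the simplex this is the interpolated connection; for a
    vector t of the simplex it is the sum of the dt_j(t) omega_j. *)
Definition mc_hat (t : 'rV[R]_n.+1) S u : M :=
  \sum_j (t 0 j)%:C *: mc S j u.

(** The three terms are the sum of the dt_j /\ omega_j, the sum of the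
    t_j d(omega_j) in which the Maurer-Cartan equation replaces d(omega_j) by a
    bracket, and half of the bracket of the connection with itself. *)
Definition curvature x v w : M :=
  mc_hat v.1 x.2 w.2 - mc_hat w.1 x.2 v.2
  - \sum_j (x.1 0 j)%:C *: lie_bracket (mc x.2 j v.2) (mc x.2 j w.2)
  + lie_bracket (mc_hat x.1 x.2 v.2) (mc_hat x.1 x.2 w.2).

Lemma dir_deriv_omega_hat x v (u : 'I_1 -> DEGamb R m n) :
  (forall j, x.2 j \in unitmx) ->
  dir_deriv_mx (@omega_hat R m n ^~ u) x v =
  mc_hat v.1 x.2 (u ord0).2 -
  \sum_j (x.1 0 j)%:C *: (mc x.2 j v.2 *m mc x.2 j (u ord0).2).
Proof.
move=> Su; apply/matrixP => a b; rewrite mxE /dir_deriv.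
rewrite -sumrB summxE.
have dterm j : has_deriv0
    (fun h => (x.1 0 j + h * v.1 0 j)%:C *
       (invmx (x.2 j + h%:C *: v.2 j) *m (u ord0).2 j) a b)
    (((v.1 0 j)%:C *: mc x.2 j (u ord0).2 -
      (x.1 0 j)%:C *: (mc x.2 j v.2 *m mc x.2 j (u ord0).2)) a b).
  have := has_deriv0M (has_deriv0_affine (x.1 0 j) (v.1 0 j))
    (has_deriv0_invmx_mul (v.2 j) ((u ord0).2 j) a b (Su j)).
  by rewrite mul0r !addr0 scale0r addr0 !mxE mulrN.
rewrite -(has_deriv0_Re_Im (has_deriv0_sum (index_enum 'I_n.+1) dterm)).
have E h : omega_hat (DEGline x v h) u a b =
    \sum_j (x.1 0 j + h * v.1 0 j)%:C *
       (invmx (x.2 j + h%:C *: v.2 j) *m (u ord0).2 j) a b.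
  by rewrite summxE; apply: eq_bigr => j _; rewrite mxE /omega !mxE ffunE.
by congr (_ +i* _); congr (derive1 _ 0); apply/funext => h; rewrite E.
Qed.

(** In the exterior derivative the two derivatives of the inverse assemble into
    minus the bracket of omega_j with itself: the Maurer-Cartan equation. *)
Lemma kappaE x (v : 'I_2 -> DEGamb R m n) :
  (forall j, x.2 j \in unitmx) ->
  kappa x v = curvature x (v (inord 0)) (v (inord 1)).
Proof.
move=> Su.
have i0 : inord 0 = ord0 :> 'I_2 by apply: val_inj; rewrite /= inordK.
have i1 : inord 1 = lift ord0 ord0 :> 'I_2.
  by apply: val_inj; rewrite /= inordK.
have extE : ext_deriv (@omega_hat R m n) x v =
    dir_deriv_mx (@omega_hat R m n ^~ (fun=> v (inord 1))) x (v (inord 0)) -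
    dir_deriv_mx (@omega_hat R m n ^~ (fun=> v (inord 0))) x (v (inord 1)).
  rewrite /ext_deriv big_ord_recl big_ord1 expr0 scale1r expr1 scaleN1r.
  have l0 : (fun l => v (lift ord0 l)) = (fun=> v (inord 1)).
    by apply/funext => l; rewrite ord1 i1.
  have l1 : (fun l => v (lift (lift ord0 ord0) l)) = (fun=> v (inord 0)).
    by apply/funext => l; rewrite (ord1 l) i0; congr v; apply: val_inj.
  by rewrite l0 l1 i0 i1.
rewrite /kappa extE !dir_deriv_omega_hat // wedge11.
have hatE d : @omega_hat R m n x (fun=> d) = mc_hat x.1 x.2 d.2 by [].
rewrite !hatE /curvature; move: (v (inord 0)) (v (inord 1)) => v0 v1.
have lieN (A B : M) : lie_bracket B A = - lie_bracket A B.
  by rewrite /lie_bracket opprB.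
rewrite (lieN (mc_hat x.1 x.2 v0.2)) opprK.
have half (A : M) : 2%:R^-1 *: (A + A) = A.
  have -> : A + A = (2%:R : C) *: A by rewrite scaler_nat mulr2n.
  by rewrite scalerA mulVf ?pnatr_eq0 // scale1r.
rewrite half; congr (_ + _).
have -> : \sum_j (x.1 0 j)%:C *: lie_bracket (mc x.2 j v0.2) (mc x.2 j v1.2) =
    \sum_j (x.1 0 j)%:C *: (mc x.2 j v0.2 *m mc x.2 j v1.2) -
    \sum_j (x.1 0 j)%:C *: (mc x.2 j v1.2 *m mc x.2 j v0.2).
  by rewrite -sumrB; apply: eq_bigr => j _; rewrite scalerBr.
by rewrite !opprB addrACA [RHS]addrACA; congr (_ + _); rewrite addrC.
Qed.

Lemma curvatureN x v w : curvature x v w = - curvature x w v.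
Proof.
have lieN (A B : M) : lie_bracket A B = - lie_bracket B A.
  by rewrite /lie_bracket opprB.
rewrite /curvature [lie_bracket (mc_hat _ _ v.2) _]lieN.
under eq_bigr do rewrite lieN scalerN.
by rewrite sumrN !opprD !opprK; congr (_ + _ + _); rewrite addrC.
Qed.

Lemma curvature_vert_vert x (v w : 'rV[R]_n.+1) :
  curvature x (v, 0) (w, 0) = 0.
Proof.
have mc0 j : mc x.2 j 0 = 0 by rewrite /mc ffunE mulmx0.
have mc_hat0 t : mc_hat t x.2 0 = 0.
  by rewrite /mc_hat big1 // => j _; rewrite mc0 scaler0.
rewrite /curvature /= !mc_hat0 /lie_bracket mulmx0 !subr0 addr0 sub0r.
by rewrite big1 ?oppr0 // => j _; rewrite mc0 mulmx0 subr0 scaler0.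
Qed.

Lemma curvature_vert_hor x (v : 'rV[R]_n.+1) u :
  curvature x (v, 0) (0, u) = mc_hat v x.2 u.
Proof.
have mc0 j : mc x.2 j 0 = 0 by rewrite /mc ffunE mulmx0.
have mc_hat0 t : mc_hat t x.2 0 = 0.
  by rewrite /mc_hat big1 // => j _; rewrite mc0 scaler0.
rewrite /curvature /= !mc_hat0 /lie_bracket mul0mx mulmx0 !subr0 addr0.
by rewrite big1 ?subr0 // => j _; rewrite mc0 mul0mx mulmx0 subr0 scaler0.
Qed.

Definition mc_bar S j u : M := mc S j u - mc S ord0 u.

(** Moving along t_i takes weight from the vertex 0, which is where the
    differences omega_i - omega_0 come from. *)
Lemma mc_hat_simplex_dt S u (l : 'I_n) :
  mc_hat (simplex_dt R l) S u = mc_bar S (lift ord0 l) u.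
Proof.
rewrite /mc_hat /mc_bar (bigD1 (lift ord0 l)) //= (bigD1 ord0) //= big1 ?addr0.
  by rewrite !mxE !eqxx /= subr0 sub0r scale1r rmorphN1 scaleN1r.
move=> j /andP[jl j0]; rewrite !mxE eqxx (negbTE jl) (negbTE j0) subr0.
by rewrite scale0r.
Qed.

Lemma lie_bracketBl (A B D : M) :
  lie_bracket (A - B) D = lie_bracket A D - lie_bracket B D.
Proof.
rewrite /lie_bracket mulmxBl mulmxBr !opprB addrACA [RHS]addrACA.
by congr (_ + _); rewrite addrC.
Qed.

Lemma lie_bracketBr (A B D : M) :
  lie_bracket D (A - B) = lie_bracket D A - lie_bracket D B.
Proof.
rewrite /lie_bracket mulmxBl mulmxBr !opprB addrACA [RHS]addrACA.
by congr (_ + _); rewrite addrC.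
Qed.

Lemma lie_bracket_suml (I : Type) (r : seq I) (t : I -> C) (A : I -> M) B :
  lie_bracket (\sum_(i <- r) t i *: A i) B =
  \sum_(i <- r) t i *: lie_bracket (A i) B.
Proof.
rewrite /lie_bracket mulmx_suml mulmx_sumr -sumrB; apply: eq_bigr => i _.
by rewrite -scalemxAl -scalemxAr scalerBr.
Qed.

Lemma lie_bracket_sumr (I : Type) (r : seq I) (t : I -> C) (A : I -> M) B :
  lie_bracket B (\sum_(i <- r) t i *: A i) =
  \sum_(i <- r) t i *: lie_bracket B (A i).
Proof.
rewrite /lie_bracket mulmx_suml mulmx_sumr -sumrB; apply: eq_bigr => i _.
by rewrite -scalemxAl -scalemxAr scalerBr.
Qed.

(** For weights of sum 1 this is the covariance of [A] and [B], with the Lie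
    bracket as product. *)
Definition lie_cov (I : finType) (t : I -> C) (A B : I -> M) : M :=
  \sum_i t i *: lie_bracket (A i) (B i) -
  lie_bracket (\sum_i t i *: A i) (\sum_i t i *: B i).

(** By bilinearity the shifts change the mean of the brackets and the bracket of
    the means by the same amount, the weights having sum 1. *)
Lemma lie_cov_shift (I : finType) (t : I -> C) (A B : I -> M) (a b : M) :
  \sum_i t i = 1 ->
  lie_cov t (fun i => A i - a) (fun i => B i - b) = lie_cov t A B.
Proof.
move=> t1; rewrite /lie_cov.
have shift (D : I -> M) d : \sum_i t i *: (D i - d) = \sum_i t i *: D i - d.
  under eq_bigr do rewrite scalerBr.
  by rewrite sumrB -scaler_suml t1 scale1r.
rewrite !shift.
have -> : \sum_i t i *: lie_bracket (A i - a) (B i - b) =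
    \sum_i t i *: lie_bracket (A i) (B i) - lie_bracket (\sum_i t i *: A i) b
    - lie_bracket a (\sum_i t i *: B i - b).
  rewrite lie_bracket_suml lie_bracketBr lie_bracket_sumr -sumrB.
  rewrite -(scale1r (lie_bracket a b)) -t1 scaler_suml -!sumrB.
  apply: eq_bigr => i _.
  by rewrite lie_bracketBl !lie_bracketBr !scalerBr.
rewrite lie_bracketBl [lie_bracket (\sum_i _) (_ - b)]lie_bracketBr.
have cancel (p q r s : M) : p - q - r - (s - q - r) = p - s.
  by rewrite !opprB addrA subrK addrA subrK.
exact: cancel.
Qed.

Lemma lie_cov0l (I : finType) (t : I -> C) (A B : I -> M) :
  (forall i, A i = 0) -> lie_cov t A B = 0.
Proof.
move=> A0; rewrite /lie_cov /lie_bracket.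
rewrite (@big1 _ _ _ _ _ _ (fun i => t i *: A i)); last first.
  by move=> i _; rewrite A0 scaler0.
rewrite mul0mx mulmx0 subrr subr0 big1 // => i _.
by rewrite A0 mul0mx mulmx0 subrr scaler0.
Qed.

Lemma lie_cov_ord2 (t : 'I_2 -> C) (A B : 'I_2 -> M) :
  A ord0 = 0 -> B ord0 = 0 ->
  lie_cov t A B =
  (t ord_max - t ord_max ^+ 2) *: lie_bracket (A ord_max) (B ord_max).
Proof.
move=> A0 B0; have E (F : 'I_2 -> M) : \sum_i F i = F ord0 + F ord_max.
  by rewrite big_ord_recl big_ord1; congr (_ + F _); apply: val_inj.
rewrite /lie_cov !E A0 B0 !scaler0 !add0r /lie_bracket.
rewrite mul0mx subrr scaler0 add0r -!scalemxAl -!scalemxAr !scalerA -expr2.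
by rewrite -scalerBr -scalerBl.
Qed.

(** The brackets of the factors and the bracket of their mean combine into a
    covariance, and recentring it at omega_0 replaces the omega_j by the
    omega_j - omega_0. *)
Lemma curvature_hor_hor (t : 'rV[R]_n.+1) S (u w : EGamb R m n) :
  \sum_j t 0 j = 1 ->
  curvature (t, S) (0, u) (0, w) =
  - lie_cov (fun j => (t 0 j)%:C) (mc_bar S ^~ u) (mc_bar S ^~ w).
Proof.
move=> t1.
have hat0 d : mc_hat (0 : 'rV_n.+1) S d = 0.
  by rewrite /mc_hat big1 // => j _; rewrite mxE scale0r.
rewrite lie_cov_shift; last by rewrite -rmorph_sum t1 rmorph1.
by rewrite /curvature /= !hat0 subrr sub0r /lie_cov opprB addrC.
Qed.

End Curvature.

(** * Integrals over the simplex *)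

Section Integrals.
Variable R : realType.

Lemma Rintegral_itvcc_cst (a b r : R) : a <= b ->
  \int[lebesgue_measure]_(x in `[a, b]) r = r * (b - a).
Proof.
move=> ab; rewrite Rintegral_cst //= lebesgue_measure_itv /= lte_fin.
by move: ab; rewrite le_eqVlt => /predU1P[<-|->//]; rewrite ltxx subrr.
Qed.

Lemma Rintegral_deriv_poly (p : {poly R}) (a b : R) : a < b ->
  \int[lebesgue_measure]_(x in `[a, b]) (p^`()).[x] = p.[b] - p.[a].
Proof.
move=> ab; rewrite /Rintegral.
rewrite (@continuous_FTC2 _ (horner p^`()) (horner p)) //=.
- by apply: continuous_subspaceT; apply: continuous_horner.
- split; first by move=> x _; apply: derivable_horner.
    by apply: cvg_at_right_filter; apply: continuous_horner.
  by apply: cvg_at_left_filter; apply: continuous_horner.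
- by move=> x _; rewrite derivE.
Qed.

Lemma simplex_iint0 n (c : R) : simplex_iint n c (fun=> 0) = 0.
Proof.
elim: n c => [|n IH] c //=.
by under eq_Rintegral do rewrite IH; rewrite Rintegral_cst // mul0r.
Qed.

Lemma simplex_int0 n : simplex_int (fun _ : 'rV[R]_n.+1 => 0) = 0.
Proof. by rewrite /simplex_int !simplex_iint0. Qed.

Lemma simplex_int1_sqr_subr (c : R[i]) :
  simplex_int (fun t : 'rV[R]_2 => (t 0 ord_max ^+ 2 - t 0 ord_max)%:C * c) =
  - (c / 6%:R).
Proof.
have intE (r : R) :
    \int[lebesgue_measure]_(x in `[0, 1]) ((x ^+ 2 - x) * r) = - (r / 6%:R).
  (* p is the primitive of the integrand that vanishes at 0. *)
  pose p : {poly R} := (r / 3%:R) *: 'X^3 - (r / 2%:R) *: 'X^2.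
  rewrite -[RHS](_ : p.[1] - p.[0] = _); last by rewrite /p !hornerE /=; field.
  rewrite -Rintegral_deriv_poly //; apply: eq_Rintegral => x _.
  by rewrite /p derivB !derivZ !derivXn !hornerE /=; field.
rewrite /simplex_int /=.
under eq_Rintegral do rewrite mxE /= ReM /= mul0r subr0.
under [X in _ +i* X]eq_Rintegral do rewrite mxE /= ImM /= mul0r addr0.
rewrite !intE; case: c => a b /=.
have -> : 6%:R = (6%:R)%:C :> R[i] by rewrite rmorph_nat.
rewrite -fmorphV /=; apply/eqP; rewrite eq_complex /=.
by rewrite !mulr0 subr0 add0r !eqxx.
Qed.

Lemma simplex_int2_cst (c : R[i]) :
  simplex_int (fun _ : 'rV[R]_3 => c) = c / 2%:R.
Proof.
have intE (r : R) : \int[lebesgue_measure]_(x in `[0, 1])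
    (\int[lebesgue_measure]_(y in `[0, (1 - x)%R]) r) = r / 2%:R.
  pose p : {poly R} := r *: 'X - (r / 2%:R) *: 'X^2.
  rewrite -[RHS](_ : p.[1] - p.[0] = _); last by rewrite /p !hornerE /=; field.
  rewrite -Rintegral_deriv_poly //; apply: eq_Rintegral => x.
  rewrite inE /= in_itv /= => /andP[_ x1].
  rewrite Rintegral_itvcc_cst ?subr_ge0 //.
  by rewrite /p derivB !derivZ derivX derivXn !hornerE /=; field.
rewrite /simplex_int /= !intE; case: c => a b /=.
have -> : 2%:R = (2%:R)%:C :> R[i] by rewrite rmorph_nat.
rewrite -fmorphV /=; apply/eqP.
by rewrite eq_complex /= !mulr0 subr0 add0r !eqxx.
Qed.

Lemma simplex_point_sum n (ss : seq R) : size ss = n ->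
  \sum_j simplex_point n ss 0 j = 1.
Proof.
move=> szs; under eq_bigr do rewrite mxE.
by rewrite big_ord_recl /= (big_nth 0) szs big_mkord subrK.
Qed.

Lemma eq_simplex_iint n (c : R) (f g : seq R -> R) :
  (forall ss, size ss = n -> f ss = g ss) ->
  simplex_iint n c f = simplex_iint n c g.
Proof.
elim: n c f g => [|n IH] c f g fg /=; first exact: fg.
by apply: eq_Rintegral => s _; apply: IH => ss szs; apply: fg; rewrite /= szs.
Qed.

(** The sample points of the iterated integral have coordinates of sum 1, also
    those outside the simplex. *)
Lemma eq_simplex_int n (f g : 'rV[R]_n.+1 -> R[i]) :
  (forall t : 'rV[R]_n.+1, \sum_j t 0 j = 1 -> f t = g t) ->
  simplex_int f = simplex_int g.
Proof.
move=> fg; rewrite /simplex_int.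
by congr (_ +i* _); apply: eq_simplex_iint => ss szs;
  rewrite fg ?simplex_point_sum.
Qed.

End Integrals.

(** * Shulman's forms of the first Pontryagin form *)

Section Shulman.
Variables (R : realType) (m : nat).
Local Notation C := R[i].
Local Notation M := 'M[C]_m.

Lemma p1C (A B : M) : p1 A B = p1 B A.
Proof. by rewrite !p1E (mxtrace_mulC B) [\tr B * _]mulrC. Qed.

Lemma p1Nl (A B : M) : p1 (- A) B = - p1 A B.
Proof. by rewrite !p1E mulNmx !raddfN /= mulNr -opprD mulrN. Qed.

Lemma p1_0l (B : M) : p1 0 B = 0.
Proof. by rewrite p1E mul0mx raddf0 mul0r subr0 mulr0. Qed.

Lemma p1Zr (c : C) (A B : M) : p1 A (c *: B) = c * p1 A B.
Proof. by rewrite !p1E -scalemxAr !mxtraceZ; ring. Qed.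

Lemma in_EG_unitmx n G (S : EGamb R m n) :
  in_EG G S -> forall j, S j \in unitmx.
Proof.
move=> SG j; move: (SG j); case: G {SG} => /= [|/andP[+ _]];
  exact: unitarymx_unit.
Qed.

Definition fiber_vectors n k (u : 'I_(k - n) -> EGamb R m n) (i : nat) :
    DEGamb R m n :=
  nth 0 ([seq (simplex_dt R l, 0) | l <- enum 'I_n] ++
         [seq (0, u l) | l <- enum 'I_(k - n)]) i.

Lemma fiber_vectors_vert n k (u : 'I_(k - n) -> EGamb R m n) (l : 'I_n) :
  fiber_vectors u l = (simplex_dt R l, 0).
Proof.
rewrite /fiber_vectors nth_cat size_map size_enum_ord ltn_ord.
by rewrite (nth_map l) ?size_enum_ord // nth_ord_enum.
Qed.

Lemma fiber_vectors_hor n k (u : 'I_(k - n) -> EGamb R m n) (l : 'I_(k - n)) :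
  fiber_vectors u (n + l) = (0, u l).
Proof.
rewrite /fiber_vectors nth_cat size_map size_enum_ord ltnNge leq_addr /= addKn.
by rewrite (nth_map l) ?size_enum_ord // nth_ord_enum.
Qed.

(** The four vectors are passed through equations so that each use can replace
    them by simplex vectors and lifts. *)
Lemma chiE n (S : EGamb R m n) (u : 'I_(4 - n) -> EGamb R m n)
    (v0 v1 v2 v3 : DEGamb R m n) :
  (forall j, S j \in unitmx) -> (n <= 4)%N ->
  fiber_vectors u 0 = v0 -> fiber_vectors u 1 = v1 ->
  fiber_vectors u 2%N = v2 -> fiber_vectors u 3%N = v3 ->
  chi S u = simplex_int (fun t : 'rV[R]_n.+1 =>
    let K := curvature (t, S) in
    (p1 (K v0 v1) (K v2 v3) - p1 (K v0 v2) (K v1 v3) +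
     p1 (K v0 v3) (K v1 v2)) *+ 2).
Proof.
move=> Su n4 <- <- <- <-; rewrite /chi /shulman /fiber_int n4.
congr simplex_int; apply/funext => t.
rewrite (wedge22 _ (Phi := curvature (t, S))); first last.
- exact: p1C.
- by move=> a b c; rewrite curvatureN p1Nl.
- by move=> w; rewrite kappaE.
by rewrite /= !inordK.
Qed.

(** Over a point the connection is the flat Maurer-Cartan form. *)
Lemma chi0 (S : EGamb R m 0) (u : 'I_(4 - 0) -> EGamb R m 0) :
  (forall j, S j \in unitmx) -> chi S u = 0.
Proof.
move=> Su; have hor := fiber_vectors_hor u.
rewrite (chiE Su isT (hor (@Ordinal 4 0 isT)) (hor (@Ordinal 4 1 isT))
  (hor (@Ordinal 4 2 isT)) (hor (@Ordinal 4 3 isT))).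
rewrite -[RHS](simplex_int0 R 0); apply: eq_simplex_int => t t1 /=.
have flat a b : curvature (t, S) (0, a) (0, b) = 0.
  rewrite (curvature_hor_hor S _ _ t1) lie_cov0l ?oppr0 // => j.
  by rewrite (ord1 j); exact: subrr.
by rewrite !flat !p1_0l subrr addr0 mul0rn.
Qed.

(** Three of the four vectors are simplex vectors (for n > 4 there is no form of
    degree 4 - n), so two of them meet in one factor of the curvature squared,
    where they give 0. *)
Lemma chi_ge3 n (S : EGamb R m n) (u : 'I_(4 - n) -> EGamb R m n) :
  (forall j, S j \in unitmx) -> (3 <= n)%N -> chi S u = 0.
Proof.
move=> Su n3; have [n4|n4] := leqP n 4; last first.
  by rewrite /chi /shulman /fiber_int leqNgt n4.
have vert k (k3 : (k < 3)%N) :=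
  fiber_vectors_vert u (Ordinal (leq_trans k3 n3)).
have [v3 v3E] : exists v3, fiber_vectors u 3%N = v3 by eexists.
rewrite (chiE Su n4 (vert 0%N isT) (vert 1%N isT) (vert 2%N isT) v3E).
rewrite -[RHS](simplex_int0 R n); congr simplex_int; apply/funext => t /=.
by rewrite !curvature_vert_vert !p1_0l subrr add0r p1C p1_0l mul0rn.
Qed.

Lemma curvature_simplex_dt n x (l : 'I_n) (u : EGamb R m n) :
  curvature x (simplex_dt R l, 0) (0, u) = mc_bar x.2 (lift ord0 l) u.
Proof. by rewrite curvature_vert_hor mc_hat_simplex_dt. Qed.

(** The two simplex vectors must go to different factors; the integrand is then
    constant, and the area 1/2 of the triangle cancels the factor 2. The sign is
    that of the permutation moving the second simplex vector past the first
    horizontal one. *)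
Lemma chi2 (S : EGamb R m 2) (u : 'I_(4 - 2) -> EGamb R m 2) :
  (forall j, S j \in unitmx) ->
  chi S u =
  ((8 * pi ^+ 2)^-1)%:C *
    (tr_mul2 (omega_bar (inord 1)) (omega_bar (inord 2)) S u -
     tr_tr (omega_bar (inord 1)) (omega_bar (inord 2)) S u).
Proof.
move=> Su.
have hor := fiber_vectors_hor u; have vert := fiber_vectors_vert u.
rewrite (chiE Su isT (vert (@Ordinal 2 0 isT)) (vert (@Ordinal 2 1 isT))
  (hor (@Ordinal 2 0 isT)) (hor (@Ordinal 2 1 isT))).
have -> : @Ordinal 2 0 isT = inord 0 by apply: val_inj; rewrite /= inordK.
have -> : @Ordinal 2 1 isT = inord 1 by apply: val_inj; rewrite /= inordK.
pose w j i := mc_bar S (inord j) (u (inord i)).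
transitivity (simplex_int (fun _ : 'rV[R]_3 =>
    (p1 (w 1%N 1%N) (w 2%N 0%N) - p1 (w 1%N 0%N) (w 2%N 1%N)) *+ 2)).
  congr simplex_int; apply/funext => t /=.
  rewrite !curvature_simplex_dt curvature_vert_vert p1_0l sub0r addrC.
  have -> : lift ord0 (inord 0 : 'I_2) = inord 1 :> 'I_3.
    by apply: val_inj; rewrite /= !inordK.
  have -> // : lift ord0 (inord 1 : 'I_2) = inord 2 :> 'I_3.
  by apply: val_inj; rewrite /= !inordK.
have half (c : C) : c *+ 2 / 2%:R = c by field.
rewrite simplex_int2_cst half.
have -> : tr_mul2 (omega_bar (inord 1)) (omega_bar (inord 2)) S u =
    \tr (w 1%N 0%N *m w 2%N 1%N) - \tr (w 1%N 1%N *m w 2%N 0%N).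
  exact: wedge11.
have -> : tr_tr (omega_bar (inord 1)) (omega_bar (inord 2)) S u =
    \tr (w 1%N 0%N) * \tr (w 2%N 1%N) - \tr (w 1%N 1%N) * \tr (w 2%N 0%N).
  exact: wedge11.
move: (w 1%N 0%N) (w 1%N 1%N) (w 2%N 0%N) (w 2%N 1%N) => a b d e.
rewrite !p1E; ring.
Qed.

(** Each splitting of the four vectors pairs omega_bar(u) with the bracket of
    the two other values, multiplied by t^2 - t, whose integral is -1/6. By
    cyclicity of the trace the three splittings contribute equally, and the term
    with tr tr drops out since a bracket has trace 0. *)
Lemma chi1 (S : EGamb R m 1) (u : 'I_(4 - 1) -> EGamb R m 1) :
  (forall j, S j \in unitmx) ->
  chi S u =
  ((24 * pi ^+ 2)^-1)%:C *
    tr_mul3 (omega_bar (inord 1)) (omega_bar (inord 1))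
            (omega_bar (inord 1)) S u.
Proof.
move=> Su; have hor := fiber_vectors_hor u.
(* The simplex vector is made abstract: comparing it with a horizontal vector
   by unfolding is expensive. *)
have [v0 v0E] : exists v0 : DEGamb R m 1, v0 = (simplex_dt R ord0, 0).
  by eexists.
have vert0 : fiber_vectors u 0 = v0.
  by rewrite v0E; apply: (fiber_vectors_vert u ord0).
rewrite (chiE Su isT vert0 (hor (@Ordinal 3 0 isT))
  (hor (@Ordinal 3 1 isT)) (hor (@Ordinal 3 2 isT))).
have -> : @Ordinal 3 0 isT = inord 0 by apply: val_inj; rewrite /= inordK.
have -> : @Ordinal 3 1 isT = inord 1 by apply: val_inj; rewrite /= inordK.
have -> : @Ordinal 3 2 isT = inord 2 by apply: val_inj; rewrite /= inordK.
have max1 : ord_max = inord 1 :> 'I_2 by apply: val_inj; rewrite /= inordK.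
pose w i := mc_bar S (inord 1) (u (inord i)).
pose c := p1 (w 0%N) (lie_bracket (w 1%N) (w 2%N)) -
          p1 (w 1%N) (lie_bracket (w 0%N) (w 2%N)) +
          p1 (w 2%N) (lie_bracket (w 0%N) (w 1%N)).
transitivity (simplex_int (fun t : 'rV[R]_2 =>
    (t 0 ord_max ^+ 2 - t 0 ord_max)%:C * (c *+ 2))).
  apply: eq_simplex_int => t t1 /=.
  have hh i j : curvature (t, S) (0, u (inord i)) (0, u (inord j)) =
      (t 0 ord_max ^+ 2 - t 0 ord_max)%:C *: lie_bracket (w i) (w j).
    rewrite (curvature_hor_hor S _ _ t1) lie_cov_ord2; try exact: subrr.
    by rewrite -scaleNr opprB -rmorphXn -rmorphB max1.
  have vh i : curvature (t, S) v0 (0, u (inord i)) = w i.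
    rewrite v0E curvature_simplex_dt; congr (mc_bar S _ _).
    by apply: val_inj; rewrite /= inordK.
  move: (curvature (t, S)) vh hh => K vh hh.
  (* f is arbitrary because comparing two values of p1 unfolds determinants. *)
  have scale (f : M -> M -> C) (x a1 a2 a3 b1 b2 b3 : _) :
      (forall (y : C) A B, f A (y *: B) = y * f A B) ->
      (f a1 (x *: b1) - f a2 (x *: b2) + f a3 (x *: b3)) *+ 2 =
      x * ((f a1 b1 - f a2 b2 + f a3 b3) *+ 2).
    by move=> fZ; rewrite !fZ; ring.
  rewrite !vh !hh; apply: (scale (@p1 R m)); exact: p1Zr.
rewrite simplex_int1_sqr_subr.
pose Phi a b := mc_bar S (inord 1) a *m mc_bar S (inord 1) b -
                mc_bar S (inord 1) b *m mc_bar S (inord 1) a.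
have -> : tr_mul3 (omega_bar (inord 1)) (omega_bar (inord 1))
    (omega_bar (inord 1)) S u =
    \tr ((w 0%N *m w 1%N - w 1%N *m w 0%N) *m w 2%N) -
    \tr ((w 0%N *m w 2%N - w 2%N *m w 0%N) *m w 1%N) +
    \tr ((w 1%N *m w 2%N - w 2%N *m w 1%N) *m w 0%N).
  apply: (wedge21 _ _ (Phi := Phi)) => [d|a b d]; first exact: wedge11.
  by rewrite -raddfN /= -mulNmx opprB.
rewrite /c; move: (w 0%N) (w 1%N) (w 2%N) => a b d.
rewrite !p1E /lie_bracket !(mulmxBl, mulmxBr) !raddfB /=.
have cycle (A B D : M) : \tr (A *m B *m D) = \tr (B *m D *m A).
  by rewrite -mulmxA mxtrace_mulC.
rewrite !mulmxA (mxtrace_mulC d b) (mxtrace_mulC d a) (mxtrace_mulC b a).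
rewrite (cycle a b d) (cycle d a b) (cycle a b d).
rewrite (cycle a d b) (cycle d b a) (cycle b a d) (cycle a d b) (cycle d b a).
have -> : ((24 * pi ^+ 2)^-1)%:C = ((8 * pi ^+ 2)^-1)%:C / 3%:R :> C.
  have -> : 3%:R = (3%:R)%:C :> C by rewrite rmorph_nat.
  rewrite -fmorphV -rmorphM; congr (_ %:C).
  by have := pi_gt0 R; move: pi => p p0; field; rewrite gt_eqF.
move: (_%:C) => e.
by field.
Qed.

End Shulman.

Theorem corollary5p3p2 (R : realType) (m : nat) (G : gauge_group) :
  (forall (S : EGamb R m 1) (u : 'I_3 -> EGamb R m 1),
      in_EG G S -> (forall l, in_TEG G S (u l)) ->
      chi S u =
      ((24 * pi ^+ 2)^-1)%:C *
        tr_mul3 (omega_bar (inord 1)) (omega_bar (inord 1))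
                (omega_bar (inord 1)) S u) /\
  (forall (S : EGamb R m 2) (u : 'I_2 -> EGamb R m 2),
      in_EG G S -> (forall l, in_TEG G S (u l)) ->
      chi S u =
      ((8 * pi ^+ 2)^-1)%:C *
        (tr_mul2 (omega_bar (inord 1)) (omega_bar (inord 2)) S u -
         tr_tr (omega_bar (inord 1)) (omega_bar (inord 2)) S u)) /\
  (forall n : nat, n <> 1%N -> n <> 2%N ->
    forall (S : EGamb R m n) (u : 'I_(4 - n) -> EGamb R m n),
      in_EG G S -> (forall l, in_TEG G S (u l)) ->
      chi S u = 0).
Proof.
split; [|split].
- by move=> S u /in_EG_unitmx Su _; apply: chi1.
- by move=> S u /in_EG_unitmx Su _; apply: chi2.
- move=> [|[|[|n]]] // n1 n2 S u /in_EG_unitmx Su _; first exact: chi0.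
  exact: chi_ge3.
Qed.
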